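(* Let $A$ be a finite alphabet and let $\mu$ denote the uniform (Lebesgue) product measure on $A^\omega\times A^\omega$. The set $I=\{(x,y)\in A^\omega\times A^\omega : x \text{ and } y \text{ are finite-state independent}\}$ satisfies $\mu(I)=1$.
   Context: A $k$-automaton is a tuple $\langle Q,A,\delta,I\rangle$ with finite state set $Q$, alphabet $A$, transition relation $\delta\subseteq Q\times(A\cup\{\varepsilon\})^k\times Q$ and set $I$ of initial states. An infinite run is an infinite sequence of consecutive transitions; its label is the componentwise concatenation $\langle x_1,\dots,x_k\rangle$ of the transition labels; it is accepting if it starts in an initial state and every $x_j$ is infinite. A $k$-automaton is $\ell$-deterministic if $I$ is a singleton and, for any two transitions $p\xrightarrow{\alpha_1,\dots,\alpha_k}q$ and $p\xrightarrow{\alpha'_1,\dots,\alpha'_k}q'$ leaving the same state $p$: if $\alpha_j=\varepsilon$ for some $j\le\ell$ then $\alpha'_j=\varepsilon$; and if $\alpha_i=\alpha'_i$ for all $i\le \ell$ then $\alpha_i=\alpha'_i$ for all $i>\ell$ and $q=q'$. Such an automaton realizes a partial function $(A^\omega)^\ell\to(A^\omega)^{k-\ell}$ (the first $\ell$ tapes are inputs, the others outputs). For a $1$-deterministic $2$-automaton $\mathcal T$ and $x=a_1a_2\cdots$ with accepting run $q_0\xrightarrow{a_1|v_1}q_1\xrightarrow{a_2|v_2}\cdots$, $\rho_{\mathcal T}(x)=\liminf_n |v_1\cdots v_n|/n$; it is one-to-one if $x\mapsto\mathcal T(x)$ is injective; $\rho(x)$ is the infimum of $\rho_{\mathcal T}(x)$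 over one-to-one $1$-deterministic $2$-automata. A compressor is a $2$-deterministic $3$-automaton $\mathcal C$ (input tapes carry $x$ and an oracle $y$, third tape is output) such that for every fixed $y$ the map $x\mapsto\mathcal C(x,y)$ is injective. For the unique accepting run $q_0\xrightarrow{\alpha_1,\beta_1|w_1}q_1\xrightarrow{\alpha_2,\beta_2|w_2}\cdots$ with $x=\alpha_1\alpha_2\cdots$, $y=\beta_1\beta_2\cdots$ ($\alpha_i,\beta_i\in A\cup\{\varepsilon\}$), $\rho_{\mathcal C}(x/y)=\liminf_n |w_1\cdots w_n|/|\alpha_1\cdots\alpha_n|$, and $\rho(x/y)$ is the infimum of $\rho_{\mathcal C}(x/y)$ over all compressors. Two infinite words $x,y$ are finite-state independent if $\rho(x/y)=\rho(x)$, $\rho(y/x)=\rho(y)$, $\rho(x)\neq0$ and $\rho(y)\neq0$.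
   Formalization: The alphabet A is assumed to have at least two letters; for a one-letter alphabet the only word has compression ratio 0, so I is empty and the claim fails. *)

(* Defs.v *)
From HB Require Import structures.
From mathcomp Require Import all_boot all_order all_algebra.
From mathcomp Require Import all_classical all_reals.
From mathcomp Require Import ereal sequences.

Set Implicit Arguments.
Unset Strict Implicit.
Unset Printing Implicit Defensive.

Import Order.TTheory GRing.Theory Num.Theory.
Local Open Scope classical_set_scope.
Local Open Scope ring_scope.

Definition stream (A : Type) := nat -> A.

(* ε is encoded as None, a letter a as Some a.                        *)
Record kautomaton (A : finType) (k : nat) := KAutomaton {
  state : finType;
  delta : {set (state * k.-tuple (option A) * state)};
  initial : {set state} }.

Section Automata.
Variables (A : finType) (k : nat) (M : kautomaton A k).

Definition transition := (state M * k.-tuple (option A) * state M)%type.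

Definition tsrc (t : transition) : state M := t.1.1.
Definition tlab (t : transition) : k.-tuple (option A) := t.1.2.
Definition tdst (t : transition) : state M := t.2.

Definition is_run (r : nat -> transition) : Prop :=
  (forall n, r n \in delta M) /\ (forall n, tdst (r n) = tsrc (r n.+1)).

Definition tape_prefix (r : nat -> transition) (j : 'I_k) (n : nat) : seq A :=
  pmap id [seq tnth (tlab (r i)) j | i <- iota 0 n].

Definition tape_label (r : nat -> transition) (j : 'I_k) (z : stream A) : Prop :=
  (forall n, tape_prefix r j n = [seq z i | i <- iota 0 (size (tape_prefix r j n))])
  /\ (forall m, exists n, m <= size (tape_prefix r j n))%N.

Definition accepting_run (r : nat -> transition) (z : 'I_k -> stream A) : Prop :=
  is_run r /\ tsrc (r 0%N) \in initial M /\ forall j, tape_label r j (z j).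

(* l-determinism (tapes 0..l-1 are inputs; the paper's j <= l is j < l here) *)
Definition deterministic (l : nat) : Prop :=
  (exists q0, forall q, q \in initial M <-> q = q0) /\
  forall p q q' (a a' : k.-tuple (option A)),
    (p, a, q) \in delta M -> (p, a', q') \in delta M ->
    (forall j : 'I_k, (j < l)%N -> tnth a j = None -> tnth a' j = None) /\
    ((forall j : 'I_k, (j < l)%N -> tnth a j = tnth a' j) ->
       (forall j : 'I_k, tnth a j = tnth a' j) /\ q = q').

Definition run_ratio (R : realType) (r : nat -> transition) (jin jout : 'I_k)
  : \bar R :=
  limn_einf (fun n => ((size (tape_prefix r jout n))%:R
                       / (size (tape_prefix r jin n))%:R : R)%:E).

End Automata.

Arguments transition {A k} M.

Definition t0 : 'I_2 := @Ordinal 2 0 isT.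
Definition t1 : 'I_2 := @Ordinal 2 1 isT.
Definition c0 : 'I_3 := @Ordinal 3 0 isT.
Definition c1 : 'I_3 := @Ordinal 3 1 isT.
Definition c2 : 'I_3 := @Ordinal 3 2 isT.

Definition tapes2 (A : Type) (x z : stream A) : 'I_2 -> stream A :=
  fun j => if (j == t0) then x else z.
Definition tapes3 (A : Type) (x y z : stream A) : 'I_3 -> stream A :=
  fun j => if (j == c0) then x else if (j == c1) then y else z.

Definition realizes2 (A : finType) (T : kautomaton A 2) (x z : stream A) : Prop :=
  exists r : nat -> transition T, accepting_run r (tapes2 x z).

Definition one_to_one (A : finType) (T : kautomaton A 2) : Prop :=
  forall x x' z, realizes2 T x z -> realizes2 T x' z -> x = x'.

Definition rho (R : realType) (A : finType) (x : stream A) : \bar R :=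
  ereal_inf [set e | exists (T : kautomaton A 2) (r : nat -> transition T) z,
     deterministic T 1 /\ one_to_one T /\
     accepting_run r (tapes2 x z) /\ e = run_ratio R r t0 t1].

Definition realizes3 (A : finType) (C : kautomaton A 3) (x y z : stream A) : Prop :=
  exists r : nat -> transition C, accepting_run r (tapes3 x y z).

Definition compressor (A : finType) (C : kautomaton A 3) : Prop :=
  deterministic C 2 /\
  forall y x x' z, realizes3 C x y z -> realizes3 C x' y z -> x = x'.

Definition rho_cond (R : realType) (A : finType) (x y : stream A) : \bar R :=
  ereal_inf [set e | exists (C : kautomaton A 3) (r : nat -> transition C) z,
     compressor C /\ accepting_run r (tapes3 x y z) /\ e = run_ratio R r c0 c2].

Definition fs_independent (R : realType) (A : finType) (x y : stream A) : Prop :=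
  rho_cond R x y = rho R x /\ rho_cond R y x = rho R y /\
  rho R x <> 0%E /\ rho R y <> 0%E.

(* The uniform (Lebesgue) product measure on A^omega x A^omega, via    *)
(* its outer measure built from cylinder sets u A^omega x v A^omega,   *)
(* each of weight |A|^-(|u|+|v|).                                     *)
Definition cylinder (A : finType) (u v : seq A) : set (stream A * stream A) :=
  [set xy | [seq xy.1 i | i <- iota 0 (size u)] = u /\
            [seq xy.2 i | i <- iota 0 (size v)] = v].

Definition cyl_weight (R : realType) (A : finType) (u v : seq A) : R :=
  (#|A|%:R ^- (size u + size v))%R.

Definition lebesgue_outer (R : realType) (A : finType)
    (S : set (stream A * stream A)) : \bar R :=
  ereal_inf [set e | exists U V : nat -> seq A,
     S `<=` \bigcup_i cylinder (U i) (V i) /\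
     e = (\sum_(i <oo) (cyl_weight R (U i) (V i))%:E)%E].

(* Main.v *)
Require Import Defs.
From HB Require Import structures.
From mathcomp Require Import all_boot all_order all_algebra.
From mathcomp Require Import all_classical all_reals.
From mathcomp Require Import ereal sequences.
From mathcomp Require Import filter normedtype.
From mathcomp Require Import zify ring lra.

(* A transducer for x can be run as a compressor that reads the oracle and ignores it, and copying
   has ratio 1, so rho(x/y) <= rho(x) <= 1 for all x and y. It therefore suffices that
   rho(x/y) >= 1 almost everywhere, and, up to renaming states there being countably many
   compressors, that each single compressor C reaches a ratio < 1 only on a null set.

   Suppose C has read u from x and v from y, with |u| = L, and written w with |w| <= L - L/m.
   If v is a prefix of a fixed y, then u is determined by |v|, w and the state: two such u could be
   exchanged without changing the output, contradicting injectivity. As long as |v| is O(L), such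
   u thus make up a fraction O(L^2) |A|^(-L/m) of all words of length L, and Borel-Cantelli
   applies. To bound |v|, take a word s such that from no state can C read s on the oracle tape
   before it reads a letter of x (unless it never reads x again); s exists by concatenating
   words that drive one state after the other to reading x. Each occurrence of s in v then costs
   a letter of x, so v contains at most L of them, and for |v| larger than a constant
   times L this has probability at most 2^(-L). *)

Set Implicit Arguments.
Unset Strict Implicit.
Unset Printing Implicit Defensive.

Import Order.TTheory GRing.Theory Num.Theory.

(** * Runs, splicing and relabelling *)

Lemma map_iota_eq (T : Type) (f g : nat -> T) n :
  [seq f i | i <- iota 0 n] = [seq g i | i <- iota 0 n] <->
  forall i, (i < n)%N -> f i = g i.
Proof.
split=> [E i ltin|E].
  have := congr1 (fun s => nth (f i) s i) E.
  by rewrite !(nth_map 0) ?size_iota // nth_iota.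
by apply/eq_in_map => i; rewrite mem_iota => /andP[_ /E].
Qed.

Section Tapes.
Variables (A : finType) (k : nat) (M : kautomaton A k).
Implicit Types (r : nat -> transition M) (j : 'I_k) (n : nat).

Definition reads r j n := tnth (tlab (r n)) j.
Definition tape_size r j n := size (tape_prefix r j n).

Lemma tape_prefixD r j n d :
  tape_prefix r j (n + d) =
  tape_prefix r j n ++ tape_prefix (fun i => r (n + i)) j d.
Proof.
rewrite /tape_prefix iotaD map_cat pmap_cat; congr (_ ++ pmap _ _).
rewrite add0n -[in LHS](addn0 n) iotaDl -map_comp.
by apply: eq_map.
Qed.

Lemma tape_prefixS r j n :
  tape_prefix r j n.+1 = tape_prefix r j n ++ seq_of_opt (reads r j n).
Proof.
rewrite -addn1 tape_prefixD; congr (_ ++ _).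
by rewrite /tape_prefix /= addn0 /reads; case: (tnth _ _).
Qed.

Lemma tape_sizeS r j n : tape_size r j n.+1 = tape_size r j n + isSome (reads r j n).
Proof. by rewrite /tape_size tape_prefixS size_cat; case: (reads r j n). Qed.

Lemma tape_sizeD r j n d :
  tape_size r j (n + d) = tape_size r j n + tape_size (fun i => r (n + i)) j d.
Proof. by rewrite /tape_size tape_prefixD size_cat. Qed.

Lemma tape_size_le r j n n' : (n <= n')%N -> (tape_size r j n <= tape_size r j n')%N.
Proof. by move=> /subnKC <-; rewrite tape_sizeD leq_addr. Qed.

(** A tape grows by at most one letter per transition, so no intermediate length is skipped. *)
Lemma tape_size_attained r j n h :
  (h <= tape_size r j n)%N -> exists2 n', (n' <= n)%N & tape_size r j n' = h.
Proof.
elim: n => [|n IH]; first by rewrite leqn0 => /eqP ->; exists 0%N.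
rewrite tape_sizeS => le_h; case: (leqP h (tape_size r j n)) => [/IH[n' ? ?]|lt].
  by exists n' => //; lia.
by exists n.+1 => //; rewrite tape_sizeS; move: le_h; case: (isSome _) => /=; lia.
Qed.

Lemma tape_prefix_stream r j (z : stream A) :
  (forall n, tape_prefix r j n = [seq z i | i <- iota 0 (tape_size r j n)]) <->
  (forall n a, reads r j n = Some a -> z (tape_size r j n) = a).
Proof.
split=> [pre n a ra|val].
  have := pre n.+1; rewrite tape_prefixS tape_sizeS ra /= addn1 -addn1 iotaD map_cat.
  by rewrite -pre cats1 /= cats1 => /rcons_inj[].
elim=> // n IH; rewrite tape_prefixS tape_sizeS.
case ra: (reads r j n) => [a|] /=; last by rewrite cats0 addn0.
by rewrite iotaD map_cat -IH /= (val _ _ ra).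
Qed.

Lemma tape_labelP r j (z : stream A) :
  tape_label r j z <->
  (forall n a, reads r j n = Some a -> z (tape_size r j n) = a) /\
  (forall m, exists n, (m <= tape_size r j n)%N).
Proof. by rewrite /tape_label -tape_prefix_stream. Qed.

Lemma tape_label_prefix r j z n i x0 : tape_label r j z ->
  (i < tape_size r j n)%N -> nth x0 (tape_prefix r j n) i = z i.
Proof.
by case=> -> _ lti; rewrite (nth_map 0) ?size_iota // nth_iota.
Qed.

Definition splice r1 n1 r2 n2 : nat -> transition M :=
  fun n => if (n < n1)%N then r1 n else r2 (n2 + (n - n1))%N.

Definition splice_tape (z1 : stream A) h1 (z2 : stream A) h2 : stream A :=
  fun i => if (i < h1)%N then z1 i else z2 (h2 + (i - h1))%N.

(** Being a run is a local property and only the tail decides whether a tape is infinite, so two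
    accepting runs can be glued wherever they meet in a state. *)
Lemma accepting_splice r1 n1 r2 n2 z1 z2 :
  accepting_run r1 z1 -> accepting_run r2 z2 -> tsrc (r1 n1) = tsrc (r2 n2) ->
  accepting_run (splice r1 n1 r2 n2)
    (fun j => splice_tape (z1 j) (tape_size r1 j n1) (z2 j) (tape_size r2 j n2)).
Proof.
move=> [[d1 c1] [i1 l1]] [[d2 c2] [i2 l2]] E.
have before j n : (n <= n1)%N -> tape_size (splice r1 n1 r2 n2) j n = tape_size r1 j n.
  elim: n => // n IH ltn; rewrite !tape_sizeS IH 1?ltnW //.
  by rewrite /reads /splice ltn.
have after j d : tape_size (splice r1 n1 r2 n2) j (n1 + d) + tape_size r2 j n2 =
                 tape_size r1 j n1 + tape_size r2 j (n2 + d).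
  elim: d => [|d IH]; first by rewrite !addn0 before.
  rewrite !addnS !tape_sizeS [in RHS]addnA -IH.
  rewrite /reads /splice ifN; last by lia.
  by rewrite (_ : n1 + d - n1 = d)%N; lia.
split; first split=> n.
- by rewrite /splice; case: ifP.
- rewrite /splice; case: (ltnP n n1) => [ltn|len].
    case: ifP => [_|nlt]; first by rewrite c1.
    have -> : n1 = n.+1 by lia.
    by rewrite subnn addn0 c1 -(_ : n1 = n.+1) ?E //; lia.
  rewrite ifN; last by lia.
  by rewrite c2 (_ : (n2 + (n.+1 - n1))%N = (n2 + (n - n1)).+1) //; lia.
split.
  (* For [n1 = 0] the glued run starts in the state of [r2] at time [n2], which is initial because
     it is the first state of [r1]. *)
  rewrite /splice; case: ifP => // h; rewrite sub0n addn0 -E.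
  by rewrite (_ : n1 = 0%N) //; lia.
move=> j; apply/tape_labelP.
have /tape_labelP[v1 u1] := l1 j; have /tape_labelP[v2 u2] := l2 j.
split=> [n a ra|m].
  case: (ltnP n n1) => [ltn|len].
    have E1 := before j n (ltnW ltn).
    rewrite E1 /splice_tape ifT.
      by apply: v1; rewrite -ra /reads /splice ltn.
    have := tape_size_le r1 j ltn; rewrite tape_sizeS.
    suff -> : isSome (reads r1 j n) by lia.
    by move: ra; rewrite /reads /splice ltn => ->.
  have := after j (n - n1)%N; rewrite subnKC // => E1.
  have le2 : (tape_size r2 j n2 <= tape_size r2 j (n2 + (n - n1)))%N.
    by apply: tape_size_le; lia.
  rewrite /splice_tape ifN; last by lia.
  rewrite (_ : (_ + _)%N = tape_size r2 j (n2 + (n - n1))); last by lia.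
  by apply: v2; rewrite -ra /reads /splice ifN //; lia.
have [n le] := u2 (m + tape_size r2 j n2)%N.
exists (n1 + (n - n2))%N; have := after j (n - n2)%N.
have : (tape_size r2 j n <= tape_size r2 j (n2 + (n - n2)))%N.
  by apply: tape_size_le; lia.
lia.
Qed.

End Tapes.

Section Relabel.
Variables (A : finType) (k : nat) (M M' : kautomaton A k) (f : state M -> state M').

Definition map_transition (t : transition M) : transition M' :=
  (f t.1.1, t.1.2, f t.2).

Lemma map_accepting (r : nat -> transition M) z :
  (forall t, t \in delta M -> map_transition t \in delta M') ->
  (forall q, q \in initial M -> f q \in initial M') ->
  accepting_run r z -> accepting_run (map_transition \o r) z.
Proof.
move=> fd fi [[d c] [i l]]; split; first split=> n /=.
- exact: fd.
- by rewrite /tdst /tsrc /= -/(tdst _) c.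
by split; [exact: fi | exact: l].
Qed.

End Relabel.

Lemma eq_tape_prefix (A : finType) (k k' : nat) (M : kautomaton A k)
    (M' : kautomaton A k') (r : nat -> transition M) (r' : nat -> transition M') j j' n :
  (forall i, reads r j i = reads r' j' i) -> tape_prefix r j n = tape_prefix r' j' n.
Proof. by move=> E; elim: n => // n IH; rewrite !tape_prefixS IH E. Qed.

Lemma eq_tape_label (A : finType) (k k' : nat) (M : kautomaton A k)
    (M' : kautomaton A k') (r : nat -> transition M) (r' : nat -> transition M') j j' z :
  (forall i, reads r j i = reads r' j' i) -> tape_label r j z -> tape_label r' j' z.
Proof.
move=> E [p u]; split=> n.
  by rewrite -!(eq_tape_prefix n E); exact: p.
by have [n' ?] := u n; exists n'; rewrite -(eq_tape_prefix n' E).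
Qed.

Lemma forall_tape2 (P : 'I_2 -> Prop) : P t0 -> P t1 -> forall j, P j.
Proof.
by move=> P0 P1 [[|[|//]] lt]; [move: P0 | move: P1]; congr P; apply: val_inj.
Qed.

Lemma forall_tape3 (P : 'I_3 -> Prop) : P c0 -> P c1 -> P c2 -> forall j, P j.
Proof.
by move=> P0 P1 P2 [[|[|[|//]]] lt]; [move: P0 | move: P1 | move: P2];
  congr P; apply: val_inj.
Qed.

(** * Transducers as compressors with an oracle *)

Section IgnoreOracle.
Variables (A : finType) (T : kautomaton A 2).

Definition drop_oracle (a : 3.-tuple (option A)) : 2.-tuple (option A) :=
  [tuple tnth a c0; tnth a c2].

(** Each transition consumes one oracle letter, whatever it is: every infinite run then reads the
    whole oracle, and the ε-condition of determinism cannot fail on tape [c1]. *)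
Definition ignore_oracle : kautomaton A 3 :=
  @KAutomaton A 3 (state T)
    [set t | isSome (tnth t.1.2 c1) &&
             ((t.1.1, drop_oracle t.1.2, t.2) \in delta T)]
    (initial T).

Lemma ignore_oracle_run (r : nat -> transition ignore_oracle) x y z :
  accepting_run r (tapes3 x y z) -> realizes2 T x z.
Proof.
move=> [[d c] [i l]].
exists (fun n => (tsrc (r n), drop_oracle (tlab (r n)), tdst (r n))).
split; first split=> n //=.
  by have := d n; rewrite inE => /andP[].
split=> //; apply: forall_tape2.
- by apply: eq_tape_label (l c0) => n; rewrite /reads.
- by apply: eq_tape_label (l c2) => n; rewrite /reads.
Qed.

Lemma run_ignore_oracle (r : nat -> transition T) x y z :
  accepting_run r (tapes2 x z) ->
  exists2 r' : nat -> transition ignore_oracle,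
    accepting_run r' (tapes3 x y z) &
    (forall n, tape_prefix r' c0 n = tape_prefix r t0 n) /\
    (forall n, tape_prefix r' c2 n = tape_prefix r t1 n).
Proof.
move=> [[d c] [i l]].
pose lab n : 3.-tuple (option A) :=
  [tuple tnth (tlab (r n)) t0; Some (y n); tnth (tlab (r n)) t1].
pose r' n : transition ignore_oracle := (tsrc (r n), lab n, tdst (r n)).
have E0 n : reads r' c0 n = reads r t0 n by [].
have E2 n : reads r' c2 n = reads r t1 n by [].
have size1 n : tape_size r' c1 n = n.
  by elim: n => // n IH; rewrite tape_sizeS IH /= addn1.
exists r'; last by split=> n; exact: eq_tape_prefix.
split; first split=> n //=.
  rewrite inE /=; suff -> : drop_oracle (lab n) = (r n).1.2.
    by rewrite -!surjective_pairing d.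
  by apply: eq_from_tnth; apply: forall_tape2.
split=> //; apply: forall_tape3.
- by apply: eq_tape_label (l t0) => n; rewrite E0.
- apply/tape_labelP; split=> [n a|m]; last by exists m; rewrite size1.
  by rewrite size1 => -[].
- by apply: eq_tape_label (l t1) => n; rewrite E2.
Qed.

Lemma ignore_oracle_compressor :
  deterministic T 1 -> one_to_one T -> compressor ignore_oracle.
Proof.
move=> [ini det] inj; split; last first.
  by move=> y x x' z [r /ignore_oracle_run rz] [r' /ignore_oracle_run rz']; exact: inj rz rz'.
split=> // p q q' a a'; rewrite !inE /= => /andP[a1 da] /andP[a1' da'].
have [eps fn] := det _ _ _ _ _ da da'; split.
  apply: forall_tape3 => // _ E.
  - have := eps t0 isT; rewrite /drop_oracle /= => H; exact: H.
  - by move: a1; rewrite E.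
move=> eq_in; case: fn => [|eqa ->]; first by apply: forall_tape2 => // _; exact: (eq_in c0).
split=> //; apply: forall_tape3; [exact: (eqa t0) | exact: eq_in | exact: (eqa t1)].
Qed.

End IgnoreOracle.

(** * The copying transducer *)

Section Identity.
Variable A : finType.

Definition copier : kautomaton A 2 :=
  @KAutomaton A 2 unit [set t | isSome (tnth t.1.2 t0) && (tnth t.1.2 t0 == tnth t.1.2 t1)]
    [set: unit].

Lemma copier_deterministic : deterministic copier 1.
Proof.
split; first by exists tt => -[]; rewrite inE.
move=> p q q' a a'; rewrite !inE /= => /andP[s0 /eqP e] /andP[s0' /eqP e']; split.
  by apply: forall_tape2 => // _ E; move: s0; rewrite E.
move=> eq_in; split; last by case: q; case: q'.
by apply: forall_tape2; rewrite -?e -?e'; exact: (eq_in t0).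
Qed.

Lemma copier_id x z : realizes2 copier x z -> x = z.
Proof.
move=> [r [[d _] [_ l]]]; apply/funext => i.
have [p0 u] := l t0; have [p1 _] := l t1.
have E n : tape_prefix r t0 n = tape_prefix r t1 n.
  apply: eq_tape_prefix => m; have := d m; rewrite inE => /andP[_ /eqP].
  exact.
have [n le] := u i.+1; have := p1 n; rewrite -!E p0 !size_map size_iota.
by move/map_iota_eq/(_ i le).
Qed.

Lemma copier_run x : exists2 r : nat -> transition copier,
  accepting_run r (tapes2 x x) & forall n, tape_prefix r t0 n = tape_prefix r t1 n.
Proof.
exists (fun n => (tt, [tuple Some (x n); Some (x n)], tt)); last first.
  by move=> n; apply: eq_tape_prefix.
have size_n j n : tape_size (fun n => (tt, [tuple Some (x n); Some (x n)], tt)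
    : transition copier) j n = n.
  move: j; apply: forall_tape2; elim: n => // n IH;
  by rewrite tape_sizeS IH /= addn1.
split; first by split=> n; rewrite ?inE /= ?eqxx.
split; first by rewrite inE.
by apply: forall_tape2; apply/tape_labelP; split=> [n a|m];
  rewrite ?size_n; (try by case); exists m; rewrite size_n.
Qed.

End Identity.

(** * Elementary bounds on compression ratios *)

Section Ratio.
Variable R : realType.
Local Open Scope ereal_scope.

Lemma limn_einfE (u : (\bar R)^nat) : limn_einf u = ereal_sup (range (einfs u)).
Proof. by rewrite limn_einf_lim; apply/cvg_lim => //; exact: cvg_einfs_sup. Qed.

Lemma limn_einf_le_bound (u : (\bar R)^nat) c : (forall n, u n <= c) -> limn_einf u <= c.
Proof.
move=> uc; rewrite limn_einfE; apply: ge_ereal_sup => _ [n _ <-].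
by apply: le_trans (uc n); apply: ereal_inf_lbound; exists n => /=.
Qed.

Lemma limn_einf_lt_frequently (u : (\bar R)^nat) c : limn_einf u < c ->
  forall n0, exists2 n, (n0 <= n)%N & u n < c.
Proof.
move=> uc n0; apply: contrapT => h; move: uc; apply/negP; rewrite -leNgt.
rewrite limn_einfE; apply: (@le_trans _ _ (einfs u n0)); last first.
  by apply: ereal_sup_ubound; exists n0.
apply: le_ereal_inf_tmp => _ [n /= le <-]; rewrite leNgt; apply/negP => lt.
by apply: h; exists n.
Qed.

Variables (A : finType) (k : nat) (M : kautomaton A k).

(** A ratio below 1 leaves room for a saving 1/m: on arbitrarily long inputs, of length L, the
    output has length at most (1 - 1/m) L. The division-free form suits the later counting. *)
Lemma run_ratio_lt1 (r : nat -> transition M) (jin jout : 'I_k) :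
  run_ratio R r jin jout < 1 ->
  (forall h, exists n, (h <= tape_size r jin n)%N) ->
  exists m, (0 < m)%N /\ forall L0, exists n, (L0 <= tape_size r jin n)%N /\
    (tape_size r jout n * m + tape_size r jin n <= tape_size r jin n * m)%N.
Proof.
move=> lt1 unb.
have [c /andP[ltc c1]] : exists c : R, (run_ratio R r jin jout < c%:E) && (c < 1)%R.
  case E : (run_ratio R r jin jout) lt1 => [s| |] //.
    rewrite lte_fin => s1; exists ((s + 1) / 2)%R; rewrite lte_fin.
    by apply/andP; split; lra.
  by move=> _; exists 0%R; rewrite ltNyr /= ltr01.
have c1' : (0 < 1 - c)%R by lra.
(* As m exceeds 1/(1 - c), it satisfies c <= 1 - 1/m. *)
pose m := (Num.bound (1 - c)^-1).+1; exists m; split=> // L0.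
have mc : (c * m%:R + 1 <= m%:R)%R.
  have : ((1 - c)^-1 < m%:R)%R.
    apply: (@lt_trans _ _ (Num.bound (1 - c)^-1)%:R%R); last by rewrite ltr_nat.
    by apply: archi_boundP; rewrite invr_ge0 ltW.
  rewrite -(ltr_pM2l c1') mulfV ?gt_eqF // => H; lra.
(* The maximum with 1 keeps the denominator of the ratio positive. *)
have [n0 le0] := unb (maxn L0 1).
have [n len ltu] := limn_einf_lt_frequently ltc n0.
have le1 := leq_trans le0 (tape_size_le r jin len).
move: le1 ltu; rewrite geq_max => /andP[leL pos]; rewrite lte_fin.
rewrite -/(tape_size r jout n) -/(tape_size r jin n).
have pos' : (0 < (tape_size r jin n)%:R :> R)%R by rewrite ltr0n.
rewrite ltr_pdivrMr // => lt.
exists n; split=> //.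
rewrite -(ler_nat R) natrD !natrM.
set a := (tape_size r jout n)%:R%R in lt *; set b := (tape_size r jin n)%:R%R in pos' lt *.
have m0 : (0 < m%:R :> R)%R by rewrite ltr0n.
have lt' : (a * m%:R < c * b * m%:R)%R by rewrite ltr_pM2r.
have le' : (b * (c * m%:R + 1) <= b * m%:R)%R by rewrite ler_pM2l.
lra.
Qed.

End Ratio.

Section Rho.
Variables (R : realType) (A : finType).
Local Open Scope ereal_scope.

Lemma rho_le1 (x : stream A) : rho R x <= 1.
Proof.
have [r acc E] := copier_run x.
apply: (@le_trans _ _ (run_ratio R r t0 t1)).
  apply: ereal_inf_lbound; exists (copier A), r, x; split.
    exact: copier_deterministic.
  split=> // u u' z /copier_id -> /copier_id ->; by [].
apply: limn_einf_le_bound => n; rewrite E lee_fin.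
(* An empty input prefix gives 0/0, which is 0 by convention; any other prefix gives 1. *)
by case: (size _) => [|h]; rewrite ?mul0r // divff ?pnatr_eq0.
Qed.

Lemma rho_cond_le_rho (x y : stream A) : rho_cond R x y <= rho R x.
Proof.
apply: le_ereal_inf_tmp => _ [T [r [z [det [inj [acc ->]]]]]].
have [r' acc' [E0 E2]] := run_ignore_oracle y acc.
apply: ereal_inf_lbound; exists (ignore_oracle T), r', z; split.
  exact: ignore_oracle_compressor.
split=> //; rewrite /run_ratio; congr limn_einf; apply/funext => n.
by rewrite E0 E2.
Qed.

(** The chain 1 <= rho(x/y) <= rho(x) <= 1 collapses, and likewise with x and y exchanged. *)
Lemma fs_independent_of_rho_cond (x y : stream A) :
  1 <= rho_cond R x y -> 1 <= rho_cond R y x -> fs_independent R x y.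
Proof.
have rhoE (u v : stream A) : 1 <= rho_cond R u v -> rho_cond R u v = 1 /\ rho R u = 1.
  move=> ge1; have le := rho_cond_le_rho u v; have le1 := rho_le1 u.
  by split; apply/eqP; rewrite eq_le ?ge1 ?le1 ?(le_trans le le1) ?(le_trans ge1 le).
move=> /rhoE[cx rx] /rhoE[cy ry]; rewrite /fs_independent cx rx cy ry.
by do 3![split=> //]; apply/eqP; rewrite onee_eq0.
Qed.

End Rho.

(** * Synchronizing words *)

Section SynchronizingWord.
Variables (A : finType) (C : kautomaton A 3) (det : deterministic C 2).

(** A synchronizing word is one that no state delays. The clause on [n'] restricts to runs that do
    read an input letter eventually, as all tails of accepting runs do. *)
Definition delays (p : state C) (s : seq A) : Prop :=
  exists (r : nat -> transition C) n, [/\ is_run r, tsrc (r 0%N) = p,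
    exists n', (0 < tape_size r c0 n')%N,
    tape_size r c0 n = 0%N & tape_prefix r c1 n = s].

Lemma delays_prefix p s t : delays p (s ++ t) -> delays p s.
Proof.
move=> [r [n [run src live e0 e1]]].
have : (size s <= tape_size r c1 n)%N by rewrite /tape_size e1 size_cat leq_addr.
move=> /tape_size_attained[n' le E]; exists r, n'; split=> //.
  by have := tape_size_le r c0 le; lia.
have := tape_prefixD r c1 n' (n - n'); rewrite subnKC // e1 => /eqP.
by rewrite eqseq_cat // => /andP[/eqP].
Qed.

(** Whether a state reads the oracle is fixed by the ε-condition, so only the letters actually read
    have to be compared; determinism then makes the transitions coincide one by one. *)
Lemma same_run (r r' : nat -> transition C) n : is_run r -> is_run r' ->
  tsrc (r 0%N) = tsrc (r' 0%N) ->
  (forall i, (i < n)%N -> (reads r c0 i = None) /\ (reads r' c0 i = None)) ->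
  (forall i a a', (i < n)%N -> tape_size r c1 i = tape_size r' c1 i ->
     reads r c1 i = Some a -> reads r' c1 i = Some a' -> a = a') ->
  (forall i, (i < n)%N -> r i = r' i) /\ tsrc (r n) = tsrc (r' n).
Proof.
move=> [d c] [d' c'] src eps agree.
suff H i : (i <= n)%N -> (forall i', (i' < i)%N -> r i' = r' i') /\ tsrc (r i) = tsrc (r' i).
  by apply: H.
elim: i => // i IH lti; have [eqr eqs] := IH (ltnW lti).
have sizeE : tape_size r c1 i = tape_size r' c1 i.
  rewrite /tape_size; congr size; rewrite /tape_prefix; congr pmap.
  by apply/eq_in_map => i'; rewrite mem_iota => /eqr ->.
have := d i; have := d' i; move: eqs (eps i lti) (fun b b' => agree i b b' lti sizeE).
rewrite /reads /tsrc /tlab.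
case Ei : (r i) => [[p a] q]; case Ei' : (r' i) => [[p' a'] q'] /= epp [n0 n0'] ag.
subst p' => di' di; have [_ dt] := det; have [eps1 fn] := dt _ _ _ _ _ di di'.
have [eps1' _] := dt _ _ _ _ _ di' di.
have [|eqa eqq] := fn.
  apply: forall_tape3 => // _; first by rewrite n0 n0'.
  move: (eps1 c1 isT) (eps1' c1 isT) ag.
  case: (tnth a c1) => [b|]; case: (tnth a' c1) => [b'|] e1 e2 ag //.
  - by rewrite (ag b b').
  - by have := e2 erefl.
  - by have := e1 erefl.
have eqri : r i = r' i by rewrite Ei Ei' eqq (eq_from_tnth eqa).
split=> [i'|]; last first.
  exact: etrans (esym (c i)) (etrans (congr1 (@tdst _ _ _) eqri) (c' i)).
by rewrite ltnS leq_eqVlt => /orP[/eqP -> //|/eqr].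
Qed.

(** The states are treated one after the other. If [p] still delays [s], a witnessing run is
    followed up to its first input letter, and [s] is prolonged to the oracle word read by then plus
    one letter; by [delays_prefix] the states already treated stay settled. *)
Lemma synchronizing_word : exists s, forall p, ~ delays p s.
Proof.
suff [s ns] : exists s, forall p, p \in enum (state C) -> ~ delays p s.
  by exists s => p; apply: ns; rewrite mem_enum.
elim: (enum (state C)) => [|p ps [s ns]]; first by exists [::].
case: (pselect (delays p s)) => [|np]; last first.
  by exists s => q; rewrite inE => /orP[/eqP -> //|/ns].
move=> [r [n [run src [n' pos] e0 e1]]].
have ex : exists i, isSome (reads r c0 i).
  apply: contrapT => h; suff : tape_size r c0 n' = 0%N by lia.
  elim: n' {pos} => // i IH; rewrite tape_sizeS IH.
  by case E : (reads r c0 i) => //; case: h; exists i; rewrite E.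
pose N := ex_minn ex.
have [readN minN] : isSome (reads r c0 N) /\ forall i, (i < N)%N -> reads r c0 i = None.
  rewrite /N; case: ex_minnP => i si mi; split=> // i' lt.
  by case E : (reads r c0 i') => //; have := mi i'; rewrite E => /(_ isT); lia.
have leN : (n <= N)%N.
  rewrite leqNgt; apply/negP => /(tape_size_le r c0).
  by rewrite e0 tape_sizeS readN; lia.
have [a _] : exists a : A, true by move: readN; case: (reads r c0 N) => // a _; exists a.
(* The extra letter forces a run that follows [r] to go beyond step [N] before it has read all of
   [w]. *)
pose w := tape_prefix r c1 N ++ [:: a].
have pre : exists t, w = s ++ t.
  exists (tape_prefix (fun i => r (n + i)%N) c1 (N - n) ++ [:: a]).
  by rewrite catA -e1 -tape_prefixD subnKC.
have [t wE] := pre.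
exists w => q; rewrite inE => /orP[/eqP ->|/ns h]; last first.
  by rewrite wE => /delays_prefix.
move=> [r' [n1 [run' src' _ e0' e1']]].
have none' i : (i < n1)%N -> reads r' c0 i = None.
  move=> lt; have := tape_size_le r' c0 lt; rewrite tape_sizeS e0'.
  by case: (reads r' c0 i) => //=; lia.
have agree i b b' : (i < minn N n1)%N -> tape_size r c1 i = tape_size r' c1 i ->
     reads r c1 i = Some b -> reads r' c1 i = Some b' -> b = b'.
  rewrite leq_min => /andP[ltN lt1] sE rb rb'.
  have E : tape_prefix r c1 i.+1 = rcons (tape_prefix r c1 i) b.
    by rewrite tape_prefixS rb cats1.
  have E' : tape_prefix r' c1 i.+1 = rcons (tape_prefix r' c1 i) b'.
    by rewrite tape_prefixS rb' cats1.
  have := tape_prefixD r c1 i.+1 (N - i.+1); rewrite subnKC // => EN.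
  have := tape_prefixD r' c1 i.+1 (n1 - i.+1); rewrite subnKC // e1' /w EN E E'.
  rewrite -catA => /eqP; rewrite eqseq_cat ?size_rcons -?/(tape_size _ _ _) ?sE //.
  by move=> /andP[/eqP/rcons_inj[]].
have [eqr eqs] := same_run (n := minn N n1) run run' (etrans src (esym src'))
  (fun i lt => conj (minN i (leq_trans lt (geq_minl _ _)))
                    (none' i (leq_trans lt (geq_minr _ _)))) agree.
(* Either [r'] reaches the state where [r] reads its first input letter and by the ε-condition must
   read one too, or it stops by step [N] with too few oracle letters read to complete [w]. *)
case: (ltnP N n1) => [ltN|le1].
  have EN : minn N n1 = N by lia.
  rewrite EN in eqs; have nN := none' N ltN.
  have [_ dt] := det; move: (proj1 run N) (proj1 run' N) eqs readN nN.
  rewrite /reads /tsrc /tlab.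
  case: (r N) => [[p0 b] q0]; case: (r' N) => [[p0' b'] q0'] /= d d' E; subst.
  by have [/(_ c0 isT) H _] := dt _ _ _ _ _ d' d; move=> sb /H E; rewrite E in sb.
have En : minn N n1 = n1 by lia.
have : tape_size r' c1 n1 = tape_size r c1 n1.
  rewrite /tape_size; congr size; rewrite /tape_prefix; congr pmap.
  by apply/eq_in_map => i'; rewrite mem_iota => lt; rewrite eqr // En.
have := tape_size_le r c1 le1.
rewrite {2}/tape_size => le2 E; move: le2; rewrite -E /tape_size e1' /w size_cat /=; lia.
Qed.

End SynchronizingWord.

(** * Counting compressed pairs of words *)

Section Blocks.
Variable A : finType.

Definition start (x : stream A) L : L.-tuple A := [tuple x i | i < L].

Definition blocks (y : stream A) k N : {ffun 'I_N -> k.-tuple A} :=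
  [ffun i : 'I_N => start (fun j => y (i * k + j)%N) k].

(** Only aligned occurrences count: distinct blocks are independent, so sums over [V] factor into
    products. *)
Definition occurrences (s : seq A) k N (V : {ffun 'I_N -> k.-tuple A}) :=
  (\sum_(i < N) (tval (V i) == s))%N.

Lemma startE (x : stream A) L : start x L = [seq x i | i <- iota 0 L] :> seq A.
Proof. by rewrite -val_enum_ord -map_comp. Qed.

Lemma start_inj (x x' : stream A) L :
  start x L = start x' L <-> forall i, (i < L)%N -> x i = x' i.
Proof.
split=> [/(congr1 val) /=|E]; first by rewrite !startE => /map_iota_eq.
by apply: val_inj; rewrite /= !startE; apply/map_iota_eq.
Qed.

Lemma blocks_inj (y y' : stream A) k N :
  blocks y k N = blocks y' k N -> forall i, (i < N * k)%N -> y i = y' i.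
Proof.
move=> E i lt; have lt' : (i %/ k < N)%N by rewrite ltn_divLR //; case: (k) lt; lia.
have := congr1 (fun V : {ffun _ -> _} => V (Ordinal lt')) E; rewrite /= !ffunE.
move/start_inj/(_ (i %% k)%N); rewrite /= -divn_eq; apply.
by rewrite ltn_mod; case: (k) lt; lia.
Qed.

Lemma occurrences_blocksS (s : seq A) y k N :
  occurrences s (blocks y k N.+1) =
  occurrences s (blocks y k N) + (tval (start (fun j => y (N * k + j)%N) k) == s).
Proof.
rewrite /occurrences big_ord_recr /= ffunE; congr (_ + _).
by apply: eq_bigr => i _; rewrite !ffunE.
Qed.

(** Exponential Markov inequality. Give the block [s] weight 1 and every other block weight 2: all
    [V] together weigh (2B - 1)^N with B = |A|^|s|, while each [V] with at most [L] occurrences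
    weighs at least 2^(N - L). *)
Lemma card_few_occurrences (s : seq A) N L :
  (#|[set V : {ffun 'I_N -> (size s).-tuple A} | occurrences s V <= L]| * 2 ^ N <=
   2 ^ L * (2 * #|A| ^ size s).-1 ^ N)%N.
Proof.
pose w (t : (size s).-tuple A) := if tval t == s then 1%N else 2%N.
have sum_w : (\sum_t w t = (2 * #|A| ^ size s).-1)%N.
  rewrite (bigD1 (in_tuple s)) //= {1}/w eqxx.
  rewrite (eq_bigr (fun=> 2%N)) => [|t]; last first.
    by rewrite /w -val_eqE /= => /negbTE ->.
  rewrite sum_nat_const cardC1 card_tuple.
  have : (0 < #|A| ^ size s)%N by rewrite -card_tuple; apply/card_gt0P; exists (in_tuple s).
  by case: (_ ^ _)%N => // B _; rewrite add1n mul2n muln2 doubleS.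
have -> : ((2 * #|A| ^ size s).-1 ^ N = \sum_(V : {ffun 'I_N -> (size s).-tuple A})
    \prod_(i < N) w (V i))%N.
  by rewrite -(bigA_distr_bigA (fun=> w)) /= sum_w prod_nat_const card_ord.
have two V : (2 ^ N = 2 ^ occurrences s V * \prod_(i < N) w (V i))%N.
  rewrite /occurrences expn_sum -big_split /=.
  rewrite -[in LHS](card_ord N) -prod_nat_const.
  by apply: eq_bigr => i _; rewrite /w; case: eqP.
rewrite -sum_nat_const big_distrr /= big_mkcond /=.
apply: leq_sum => V _; rewrite inE; case: ifP => // le.
by rewrite (two V) leq_mul2r leq_exp2l ?le ?orbT.
Qed.

(* Bernoulli: [(1 + 1/b)^(3 b) >= 4] *)
Lemma four_mul_expn_le b : (0 < b)%N -> (4 * b ^ (3 * b) <= b.+1 ^ (3 * b))%N.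
Proof.
case: b => // b _; set c := b.+1.
have bern n : (c ^ n * (c + n) <= c.+1 ^ n * c)%N.
  elim: n => [|n IH]; first by rewrite addn0.
  have : (c.+1 * (c ^ n * (c + n)) <= c.+1 * (c.+1 ^ n * c))%N by rewrite leq_mul2l IH orbT.
  move=> h; rewrite !expnS -[X in (_ <= X)%N]mulnA; apply: leq_trans h.
  rewrite -mulnA mulnCA [X in (_ <= X)%N]mulnCA leq_mul2l; apply/orP; right; nia.
have := bern (3 * c)%N; have -> : (c + 3 * c = 4 * c)%N by lia.
by rewrite mulnA leq_mul2r /= mulnC.
Qed.

(** With B = |A|^|s|, the choice of [N] makes (2B / (2B - 1))^N at least 4^L; this absorbs the
    factor 2^L of [card_few_occurrences] and leaves a probability of at most 2^(-L). *)
Lemma few_occurrences_rare (s : seq A) L N : (0 < #|A|)%N ->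
  N = (3 * (2 * #|A| ^ size s).-1 * L)%N ->
  (#|[set V : {ffun 'I_N -> (size s).-tuple A} | occurrences s V <= L]| * 2 ^ L <=
   (#|A| ^ size s) ^ N)%N.
Proof.
move=> A0 NE; set B := (#|A| ^ size s)%N; set b := (2 * B).-1.
have B0 : (0 < B)%N by rewrite expn_gt0 A0.
have := card_few_occurrences s N L; rewrite -/B -/b; set K := #|_| => le.
have : (4 ^ L * b ^ N <= (2 * B) ^ N)%N.
  have -> : (2 * B)%N = b.+1 by rewrite /b; lia.
  rewrite NE !expnM -expnMn; case: (L) => // L'; rewrite leq_exp2r //.
  by rewrite -/B -/b -!expnM; apply: four_mul_expn_le; rewrite /b; lia.
rewrite expnMn (_ : 4 = 2 * 2)%N // expnMn => le'.
rewrite -(leq_pmul2l (_ : 0 < 2 ^ N)%N) ?expn_gt0 //.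
apply: leq_trans le'.
rewrite -[X in (_ <= X)%N]mulnA (_ : _ * _ = 2 ^ L * (K * 2 ^ N))%N; last by ring.
by rewrite leq_mul2l le orbT.
Qed.

End Blocks.

(** * Pairs of words on which a compressor saves output *)

Section CompressedPairs.
Variables (A : finType) (C : kautomaton A 3).

(** While the oracle head crosses a block equal to [s], at least one input letter is read; otherwise
    the state at the start of the block would delay [s]. *)
Lemma occurrences_le_input (s : seq A) (r : nat -> transition C) x y z n N :
  (forall p : state C, ~ delays p s) -> accepting_run r (tapes3 x y z) ->
  (N * size s <= tape_size r c1 n)%N ->
  (occurrences s (blocks y (size s) N) <= tape_size r c0 n)%N.
Proof.
move=> sync [[d c] [_ l]]; elim: N n => [|N IH] n le.
  by rewrite /occurrences big_ord0.
rewrite occurrences_blocksS.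
have [n' len' E'] : exists2 n', (n' <= n)%N & tape_size r c1 n' = (N * size s)%N.
  by apply: tape_size_attained; lia.
have := IH n'; rewrite E' leqnn => /(_ isT).
move=> /leq_trans IH'; have le0 := tape_size_le r c0 len'.
case: eqP => [E|_]; last by rewrite addn0; exact: IH'.
rewrite addn1; apply: leq_ltn_trans (IH' _ (leqnn _)) _.
rewrite ltn_neqAle le0 andbT; apply/negP => /eqP E0.
(* The tail from the moment at which exactly the first [N] blocks have been read. *)
pose r' i := r (n' + i)%N.
have shift j m : tape_size r j (n' + m) = (tape_size r j n' + tape_size r' j m)%N.
  exact: tape_sizeD.
have [m lem Em] : exists2 m, (m <= n - n')%N & tape_size r' c1 m = size s.
  by apply: tape_size_attained; have := shift c1 (n - n')%N; rewrite subnKC //; lia.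
apply: (sync (tsrc (r n'))); exists r', m; split.
- by split=> i; rewrite /r' ?d // c addnS.
- by rewrite /r' addn0.
- have [_ /(_ (tape_size r c0 n').+1)[i lti]] := l c0.
  exists (i - n')%N; have lei : (n' <= i)%N.
    by rewrite leqNgt; apply/negP => /ltnW/(tape_size_le r c0); rewrite /tape_size in lti *; lia.
  by have := shift c0 (i - n')%N; rewrite subnKC //; rewrite /tape_size in lti *; lia.
- have := tape_size_le r' c0 lem; have := shift c0 (n - n')%N; rewrite subnKC //; lia.
have [p1 _] := l c1; have := p1 (n' + m)%N.
rewrite -/(tape_size r c1 (n' + m)) shift Em iotaD map_cat tape_prefixD (p1 n').
move/eqP; rewrite eqseq_cat ?size_map ?size_iota // => /andP[_ /eqP ->].
rewrite E' -[RHS]E startE -[in LHS](addn0 (0 + _)%N) iotaDl -map_comp.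
by apply: eq_map.
Qed.

Definition compressed L k N h (p : L.-tuple A * {ffun 'I_N -> k.-tuple A}) : Prop :=
  exists (r : nat -> transition C) x y z n,
  [/\ accepting_run r (tapes3 x y z), p = (start x L, blocks y k N),
      tape_size r c0 n = L & (tape_size r c2 n <= h)%N].

(** The oracle head is still inside the [N * k] letters recorded in [p], so the blocks determine all
    that has been read of the oracle. *)
Definition compressed_early L k N h (p : L.-tuple A * {ffun 'I_N -> k.-tuple A}) : Prop :=
  exists (r : nat -> transition C) x y z n,
  [/\ accepting_run r (tapes3 x y z), p = (start x L, blocks y k N),
      tape_size r c0 n = L, (tape_size r c1 n <= N * k)%N & (tape_size r c2 n <= h)%N].

Hypothesis comp : compressor C.

(* Otherwise the two initial segments of the input could be exchanged without changing the output. *)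
Lemma configuration_inj (r r' : nat -> transition C) x y z x' y' z' n n' :
  accepting_run r (tapes3 x y z) -> accepting_run r' (tapes3 x' y' z') ->
  tsrc (r n) = tsrc (r' n') ->
  tape_size r c0 n = tape_size r' c0 n' ->
  tape_size r c1 n = tape_size r' c1 n' ->
  tape_prefix r c2 n = tape_prefix r' c2 n' ->
  (forall i, (i < tape_size r c1 n)%N -> y i = y' i) ->
  forall i, (i < tape_size r c0 n)%N -> x i = x' i.
Proof.
move=> acc acc' src E0 E1 E2 Ey i lti.
have := accepting_splice acc acc' src.
set w := (fun j => splice_tape _ _ _ _) => accw.
(* The agreeing prefixes make the glued run carry the oracle [y'] and the output [z']; only its
   input can differ from [x']. *)
have wE : w = tapes3 (w c0) y' z'.
  apply/funext; apply: forall_tape3 => //; apply/funext => h.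
    rewrite /w /splice_tape /tapes3 /=; case: ltnP => [/Ey //|le].
    by congr y'; lia.
  rewrite /w /splice_tape /tapes3 /=; case: ltnP => [lt|le].
    have [_ [_ l]] := acc; have [_ [_ l']] := acc'.
    have lt' : (h < tape_size r' c2 n')%N by move: lt; rewrite /tape_size E2.
    have e := tape_label_prefix (z h) (l c2) lt; rewrite E2 in e.
    exact: etrans (esym e) (tape_label_prefix (z h) (l' c2) lt').
  by congr z'; move: le; rewrite /tape_size E2; lia.
have := comp.2 y' (w c0) x' z'; rewrite /realizes3 => inj.
have <- : w c0 = x'.
  by apply: inj; [exists (splice r n r' n'); rewrite -wE | exists r'].
by rewrite /w /splice_tape lti.
Qed.

(** By [configuration_inj] a pair is recovered from its blocks together with the state, the oracle
    position and the output, so it suffices to count these records. *)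
Lemma card_compressed_early L k N h : (0 < #|A|)%N ->
  (#|[set p | `[< @compressed_early L k N h p >]]| <=
   (#|A| ^ k) ^ N * (#|state C| * (N * k).+1 * (h.+1 * #|A| ^ h)))%N.
Proof.
move=> /card_gt0P[a0 _].
have [[q0 _] _] := comp.1.
(* The output is padded with [a0] to length [h]; its true length is stored beside it. *)
pose config := ({ffun 'I_N -> k.-tuple A} *
  (state C * 'I_(N * k).+1 * ('I_h.+1 * h.-tuple A)))%type.
pose wit (p : L.-tuple A * {ffun 'I_N -> k.-tuple A}) (e : config) :=
  exists (r : nat -> transition C) x y z n,
  [/\ accepting_run r (tapes3 x y z), p = (start x L, blocks y k N),
      tape_size r c0 n = L, (tape_size r c1 n <= N * k)%N & (tape_size r c2 n <= h)%N] /\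
  e = (blocks y k N, (tsrc (r n), inord (tape_size r c1 n),
        (inord (tape_size r c2 n), start (nth a0 (tape_prefix r c2 n)) h))).
have [f fP] : exists f : _ -> config, forall p, compressed_early h p -> wit p (f p).
  suff : forall p, exists e, compressed_early h p -> wit p e by move=> /choice[f]; exists f.
  move=> p; case: (pselect (compressed_early h p)) => [[r [x [y [z [n H]]]]]|nc].
    by eexists => _; exists r, x, y, z, n; split.
  by exists (p.2, (q0, ord0, (ord0, [tuple a0 | i < h]))).
have f_inj : {in [set p | `[< @compressed_early L k N h p >]] &, injective f}.
  move=> p p'; rewrite !inE => cp cp'.
  have [r [x [y [z [n [[acc -> L0 l1 l2] ->]]]]]] := fP _ cp.
  have [r' [x' [y' [z' [n' [[acc' -> L0' l1' l2'] ->]]]]]] := fP _ cp'.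
  move=> E; have Eb := congr1 fst E; have Eq := congr1 (fun e => e.2.1.1) E.
  have E1 := congr1 (fun e => e.2.1.2) E; have E2 := congr1 (fun e => e.2.2.1) E.
  have Et := congr1 (fun e => e.2.2.2) E; rewrite /= in Eb Eq E1 E2 Et.
  have {}E1 : tape_size r c1 n = tape_size r' c1 n'.
    by move/(congr1 val): E1; rewrite /= !inordK.
  have {}E2 : tape_size r c2 n = tape_size r' c2 n'.
    by move/(congr1 val): E2; rewrite /= !inordK.
  congr (_, _) => //; apply/start_inj; rewrite -{1}L0.
  apply: (configuration_inj acc acc' Eq) => //; first by rewrite L0.
    apply: (@eq_from_nth _ a0) => // i lti; move/start_inj: Et; apply.
    exact: leq_trans lti _.
  by move=> i lti; apply: (blocks_inj Eb); exact: leq_trans lti _.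
rewrite -(card_in_imset f_inj); apply: leq_trans (max_card _) _.
by rewrite !card_prod card_ffun !card_tuple !card_ord.
Qed.

(** A pair that is not early has all its [N] blocks read within [L] input letters, hence at most [L]
    occurrences of [s], which is rare. *)
Lemma card_compressed s L N h : (0 < #|A|)%N -> (forall p : state C, ~ delays p s) ->
  N = (3 * (2 * #|A| ^ size s).-1 * L)%N ->
  (#|[set p | `[< @compressed L (size s) N h p >]]| * 2 ^ L <=
   (#|A| ^ size s) ^ N *
     (#|A| ^ L + #|state C| * (N * size s).+1 * (h.+1 * #|A| ^ h) * 2 ^ L))%N.
Proof.
move=> A0 sync NE; have rare := few_occurrences_rare A0 NE.
have early := card_compressed_early L (size s) N h A0.
set F := [set V | _] in rare.
have sub : [set p | `[< @compressed L (size s) N h p >]] \subset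
    [set p | `[< @compressed_early L (size s) N h p >]] :|: finset.setX [set: L.-tuple A] F.
  apply/fintype.subsetP => p; rewrite !inE => -[r [x [y [z [n [acc -> L0 l2]]]]]].
  case: (leqP (tape_size r c1 n) (N * size s)) => le.
    by apply/orP; left; apply/asboolP; exists r, x, y, z, n.
  apply/orP; right; rewrite /= -L0; apply: occurrences_le_input acc _ => //.
  exact: ltnW.
have := leq_trans (subset_leq_card sub) (leq_card_setU _ _); rewrite cardsX cardsT card_tuple.
move=> le; apply: leq_trans (leq_mul le (leqnn _)) _.
rewrite mulnDl addnC mulnDr leq_add //.
  by rewrite -mulnA [X in (_ <= X)%N]mulnC leq_mul2l rare orbT.
by rewrite [X in (_ <= X)%N]mulnA leq_mul2r early orbT.
Qed.

End CompressedPairs.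

(** * Null sets *)

(** The fourth power serves a quadratic number of configurations times the quadratic rate of
    [null_borel_cantelli]. *)
Lemma expn4_le t : (t.+1 ^ 4 <= 256 * 2 ^ t)%N.
Proof.
have le4 : (t.+1 <= 4 * (t %/ 4).+1)%N by rewrite mulnC; exact: ltn_ceil.
apply: (@leq_trans ((4 * 2 ^ (t %/ 4)) ^ 4)).
  rewrite leq_exp2r //; apply: leq_trans le4 _; rewrite leq_mul2l /=.
  exact: ltn_expl.
rewrite expnMn -expnM leq_mul2l leq_exp2l //=; exact: leq_divM.
Qed.

Section NullSets.
Local Open Scope classical_set_scope.
Local Open Scope ring_scope.
Variables (R : realType) (A : finType).
Implicit Types (Q : pred (seq A * seq A)) (S : set (stream A * stream A)).

Definition weight (p : seq A * seq A) : R := cyl_weight R p.1 p.2.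

Lemma weight_ge0 p : 0 <= weight p.
Proof. by rewrite /weight /cyl_weight invr_ge0 exprn_ge0. Qed.

(** The total weight of the countable family [Q], bounded through its finite subfamilies so that no
    enumeration is involved. *)
Definition weight_le Q (e : R) := forall F : seq (seq A * seq A),
  uniq F -> all Q F -> \sum_(p <- F) weight p <= e.

Definition covers Q S := forall xy, S xy -> exists2 p, Q p & cylinder p.1 p.2 xy.

Definition null S := forall e : R, 0 < e -> exists2 Q, covers Q S & weight_le Q e.

Lemma weight_le_bigcup (Q : nat -> pred (seq A * seq A)) (e : nat -> R) b :
  (forall i, weight_le (Q i) (e i)) -> (forall K, \sum_(i < K) e i <= b) ->
  weight_le (fun p => `[< exists i, Q i p >]) b.
Proof.
move=> Qe eb F uF QF.
(* A finite subfamily of the union already lies in finitely many of the [Q i]. *)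
have [K KP] : exists K, forall p, p \in F -> exists2 i : 'I_K, true & Q i p.
  elim: F QF {uF} => [|p F IH] /=; first by exists 0%N.
  move=> /andP[/asboolP[i Qi] /IH[K KP]]; exists (maxn i.+1 K) => p'.
  rewrite inE => /orP[/eqP ->|/KP[j _ Qj]].
    by exists (Ordinal (leq_maxl i.+1 K)).
  by exists (widen_ord (leq_maxr i.+1 K) j).
apply: le_trans (eb K); apply: le_trans (_ : \sum_(i < K) \sum_(p <- F | Q i p) weight p <= _).
  under [X in _ <= X]eq_bigr do rewrite big_mkcond /=.
  rewrite exchange_big /= !big_seq; apply: ler_sum => p /KP[i _ Qi].
  rewrite (bigD1 i) //= Qi lerDl; apply: sumr_ge0 => j _.
  by case: ifP => // _; exact: weight_ge0.
apply: ler_sum => i _; rewrite -big_filter; apply: Qe; first exact: filter_uniq.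
exact: filter_all.
Qed.

Lemma null_bigcup (S : nat -> set (stream A * stream A)) :
  (forall i, null (S i)) -> null [set xy | exists i, S i xy].
Proof.
move=> nS e e0.
have /choice[Q QP] : forall i, exists Q, covers Q (S i) /\ weight_le Q (e / 2 ^+ i.+1).
  by move=> i; have [|Q ? ?] := nS i (e / 2 ^+ i.+1); [rewrite divr_gt0 ?exprn_gt0 | exists Q].
exists (fun p => `[< exists i, Q i p >]).
  move=> xy [i /(proj1 (QP i))[p Qp cp]]; exists p => //; apply/asboolP; by exists i.
apply: weight_le_bigcup (fun i => proj2 (QP i)) _ => K.
suff -> : \sum_(i < K) e / 2 ^+ i.+1 = e * (1 - (2 ^+ K)^-1).
  by rewrite ler_piMr ?ltW // lerBlDr lerDl invr_ge0 exprn_ge0.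
elim: K => [|K IH]; first by rewrite big_ord0 expr0 invr1 subrr mulr0.
rewrite big_ord_recr /= IH exprS; field.
by rewrite expf_neq0 // pnatr_eq0.
Qed.

Lemma null_subset S S' : S `<=` S' -> null S' -> null S.
Proof. by move=> sub n e /n[Q cov w]; exists Q => // xy /sub /cov. Qed.

Lemma null_exists (I : countType) (S : I -> set (stream A * stream A)) :
  (forall i, null (S i)) -> null [set xy | exists i, S i xy].
Proof.
move=> nS.
apply: (null_subset (S' := [set xy | exists n, exists2 i, unpickle n = Some i & S i xy])).
  by move=> xy [i Si]; exists (pickle i); exists i => //; rewrite pickleK.
apply: null_bigcup => n; case E : (unpickle n) => [i|].
  by apply: null_subset (nS i) => xy [j [<-]].
by move=> e e0; exists pred0 => [xy [] //|[|//] _ _]; rewrite big_nil ltW.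
Qed.

Lemma null_swap S : null S -> null [set xy | S (xy.2, xy.1)].
Proof.
move=> nS e /nS[Q cov w]; exists (fun p => Q (p.2, p.1)).
  by move=> xy /cov[p Qp [c1 c2]]; exists (p.2, p.1) => //; case: p Qp {c1 c2}.
move=> F uF QF; have := w [seq (p.2, p.1) | p <- F].
rewrite map_inj_uniq => [|[u v] [u' v'] [-> ->] //].
rewrite all_map big_map => /(_ uF QF); congr (_ <= _); apply: eq_bigr => p _.
by rewrite /weight /cyl_weight addnC.
Qed.

(** The rate telescopes as D/(L + 1) - D/(L + 2), so the families from [L0] on, which still cover
    [S], weigh at most D/(L0 + 1). *)
Lemma null_borel_cantelli S (Q : nat -> pred (seq A * seq A)) (D : nat) :
  (forall L, weight_le (Q L) (D%:R / (L.+1%:R * L.+2%:R))) ->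
  (forall xy, S xy -> forall L0, exists L, (L0 <= L)%N /\
     exists2 p, Q L p & cylinder p.1 p.2 xy) ->
  null S.
Proof.
move=> QD io e e0.
pose L0 := Num.bound (D%:R / e).
exists (fun p => `[< exists i, Q (L0 + i)%N p >]).
  move=> xy /io/(_ L0)[L [le [p Qp cp]]]; exists p => //; apply/asboolP.
  by exists (L - L0)%N; rewrite subnKC.
apply: (weight_le_bigcup (fun i => QD (L0 + i)%N)) => K.
have -> : \sum_(i < K) (D%:R / ((L0 + i).+1%:R * (L0 + i).+2%:R) : R) =
    D%:R / L0.+1%:R - D%:R / (L0 + K).+1%:R.
  elim: K => [|K IH]; first by rewrite big_ord0 addn0 subrr.
  rewrite big_ord_recr /= IH addnS -[(L0 + K).+2%:R]natr1.
  have : (L0 + K).+1%:R + 1 != 0 :> R by rewrite natr1 pnatr_eq0.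
  have : (L0 + K).+1%:R != 0 :> R by rewrite pnatr_eq0.
  move: (L0 + K).+1%:R => a a0 a1; rewrite -addrA; congr (_ + _).
  by field; rewrite a0 a1.
apply: (@le_trans _ _ (D%:R / L0.+1%:R)); first by rewrite gerBl divr_ge0.
rewrite ler_pdivrMr ?ltr0n // -ler_pdivrMl // mulrC.
apply: ltW; apply: lt_le_trans (archi_boundP _) _; first by rewrite divr_ge0 // ltW.
by rewrite ler_nat.
Qed.

Hypothesis A2 : (2 <= #|A|)%N.

Lemma null_lebesgue_outer S : null S -> lebesgue_outer R S = 0%E.
Proof.
move=> nS; have /card_gt0P[a0 _] : (0 < #|A|)%N by exact: ltnW.
have w0 (U V : nat -> seq A) i : (0 <= (cyl_weight R (U i) (V i))%:E)%E.
  by rewrite lee_fin; exact: (weight_ge0 (U i, V i)).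
apply/eqP; rewrite eq_le; apply/andP; split; last first.
  by apply: le_ereal_inf_tmp => _ [U [V [_ ->]]]; apply: nneseries_ge0 => i _ _; exact: w0.
apply/lee_addgt0Pr => e e0; rewrite add0e.
have [Q cov wQ] := nS (e / 2) (divr_gt0 e0 (ltr0n _ 2)).
(* As 2^c > c > 4/e, the padding cylinders weigh at most 2 * 2^(-c) <= e/2 in total; the other half
   of [e] goes to [Q]. *)
pose c := (Num.bound (e / 4)^-1).
(* [lebesgue_outer] requires covers indexed by all of [nat]; unused indices get tiny cylinders. *)
pose pad n : seq A * seq A := (nseq (n + c) a0, [::]).
pose pick n := if pickle_inv n is Some p then if Q p then Some p else None else None.
pose f n := odflt (pad n) (pick n).
apply: (@le_trans _ _ (\sum_(i <oo) (cyl_weight R (f i).1 (f i).2)%:E)%E).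
  apply: ereal_inf_lbound; exists (fun n => (f n).1), (fun n => (f n).2); split=> //.
  move=> xy /cov[p Qp cp]; exists (pickle p) => //=.
  by rewrite /f /pick pickleK_inv Qp.
apply: lime_le; first by apply: is_cvg_nneseries => n _ _; exact: (w0 (fst \o f) (snd \o f)).
apply: nearW => K; rewrite sumEFin lee_fin.
have padE n : weight (pad n) <= (2 ^+ c)^-1 * (2 ^+ n)^-1.
  rewrite /weight /cyl_weight /pad /= size_nseq addn0 exprD invfM mulrC.
  by apply: ler_pM; rewrite ?invr_ge0 ?exprn_ge0 //;
    rewrite lef_pV2 ?posrE ?exprn_gt0 ?ltr0n ?(ltnW A2) //; apply: lerXn2r;
    rewrite ?nnegrE ?ler0n // ler_nat.
pose G := pmap pick (iota 0 K).
have split_sum : \sum_(0 <= n < K) weight (f n) <=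
    \sum_(p <- G) weight p + \sum_(0 <= n < K) weight (pad n).
  rewrite /G /index_iota subn0; elim: (iota 0 K) => [|n s IH]; first by rewrite !big_nil addr0.
  rewrite /= !big_cons {1}/f; case: (pick n) => [p|] /=.
    rewrite big_cons -addrA lerD2l; apply: le_trans IH _.
    by rewrite lerD2l lerDr weight_ge0.
  by rewrite addrCA lerD2l.
apply: le_trans split_sum _; rewrite [leRHS](splitr e); apply: lerD.
  apply: wQ.
    have pickK : ocancel pick pickle.
      rewrite /pick => n; have := @pickle_invK (seq A * seq A)%type n.
      by case: (pickle_inv n) => //= p; case: (Q p).
    by apply: (pmap_uniq pickK); exact: iota_uniq.
  apply/allP => p; rewrite mem_pmap => /mapP[n _]; rewrite /pick.
  by case: (pickle_inv n) => // p'; case: ifP => // Qp [->].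
apply: (@le_trans _ _ (\sum_(0 <= n < K) (2 ^+ c)^-1 * (2 ^+ n)^-1)).
  by apply: ler_sum => n _; exact: padE.
have geo : \sum_(0 <= n < K) (2 ^+ n)^-1 <= 2 :> R.
  suff -> : \sum_(0 <= n < K) (2 ^+ n)^-1 = 2 - 2 * (2 ^+ K)^-1 :> R.
    by rewrite gerBl mulr_ge0 // invr_ge0 exprn_ge0.
  elim: K {G} => [|K IH]; first by rewrite big_nil expr0 invr1 mulr1 subrr.
  by rewrite big_nat_recr //= IH exprS; field; rewrite expf_neq0 // pnatr_eq0.
rewrite -big_distrr /=; apply: (@le_trans _ _ ((2 ^+ c)^-1 * 2)).
  by rewrite ler_pM2l // invr_gt0 exprn_gt0.
have e4 : 0 < e / 4 by rewrite divr_gt0.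
have : (2 ^+ c)^-1 <= e / 4.
  rewrite -[e / 4]invrK lef_pV2 ?posrE ?exprn_gt0 ?invr_gt0 //.
  apply: ltW; apply: lt_le_trans (archi_boundP _) _; first by rewrite invr_ge0 ltW.
  by rewrite -natrX ler_nat ltnW // ltn_expl.
by move=> h; lra.
Qed.

End NullSets.

(** * Each compressor fails almost everywhere *)

Section CompressorNull.
Local Open Scope classical_set_scope.
Variables (R : realType) (A : finType).
Hypothesis A2 : (2 <= #|A|)%N.

(** Saving t = [L %/ m] output letters gains a factor 2^t, which beats every polynomial in [L]
    because L + 1 <= m (t + 1). *)
Lemma card_compressed_growth (C : kautomaton A 3) (s : seq A) m :
  compressor C -> (forall p : state C, ~ delays p s) -> (0 < m)%N ->
  exists D, forall L N, N = (3 * (2 * #|A| ^ size s).-1 * L)%N ->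
  (#|finset (fun p => `[< @compressed A C L (size s) N (L - L %/ m) p >])| * (L.+1 * L.+2) <=
   D * ((#|A| ^ size s) ^ N * #|A| ^ L))%N.
Proof.
move=> comp sync m0; have A0 := ltnW A2.
pose c := (3 * (2 * #|A| ^ size s).-1 * size s)%N.
(* The 2 comes from (L + 1)(L + 2) <= 2 (L + 1)^2, the middle factor from the number of
   configurations, and m^4 and 256 from (L + 1)^4 <= m^4 (t + 1)^4 <= 256 m^4 2^t. *)
exists (2 * (#|state C| * c.+1).+1 * m ^ 4 * 256)%N => L N NE.
have := card_compressed comp (L - L %/ m)%N A0 sync NE.
set K := #|_|; set P := ((#|A| ^ size s) ^ N)%N; set t := (L %/ m)%N => le.
have tL : (t <= L)%N by exact: leq_div.
have N1 : ((N * size s).+1 <= c.+1 * L.+1)%N.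
  by have -> : (N * size s = c * L)%N; [rewrite NE /c; ring | nia].
have L1 : (L.+1 <= m * t.+1)%N by rewrite mulnC; exact: ltn_ceil.
set S := (#|state C| * (N * size s).+1 * (L - t).+1)%N.
have S1 : (S.+1 <= (#|state C| * c.+1).+1 * L.+1 ^ 2)%N.
  have : (S <= #|state C| * (c.+1 * L.+1) * L.+1)%N.
    by rewrite /S -mulnA -[X in (_ <= X)%N]mulnA leq_mul2l leq_mul ?orbT // ltnS leq_subr.
  have -> : (#|state C| * (c.+1 * L.+1) * L.+1 = #|state C| * c.+1 * L.+1 ^ 2)%N by ring.
  by move=> h; rewrite mulSn -add1n leq_add // expn_gt0.
have Kt : (K * 2 ^ t <= P * #|A| ^ L * S.+1)%N.
  rewrite -(leq_pmul2r (_ : 0 < 2 ^ L)%N) ?expn_gt0 //.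
  apply: (@leq_trans (P * (#|A| ^ L + S * #|A| ^ (L - t) * 2 ^ L) * 2 ^ t)).
    rewrite mulnAC leq_mul2r; apply/orP; right; apply: leq_trans le _.
    by rewrite /S !mulnA.
  have h1 : (2 ^ t <= 2 ^ L)%N by rewrite leq_exp2l.
  have h2 : (#|A| ^ (L - t) * 2 ^ t <= #|A| ^ L)%N.
    rewrite -{2}(subnK tL) expnD leq_mul2l; apply/orP; right.
    by case: (t) => // t'; rewrite leq_exp2r.
  rewrite -!mulnA leq_mul2l; apply/orP; right; rewrite mulnDl [X in (_ <= X)%N]mulnA.
  rewrite mulnS mulnDl; apply: leq_add; first by rewrite leq_mul2l h1 orbT.
  rewrite [X in (X <= _)%N](_ : _ = S * 2 ^ L * (#|A| ^ (L - t) * 2 ^ t))%N; last first.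
    by rewrite /S; ring.
  rewrite [X in (_ <= X)%N](_ : _ = S * 2 ^ L * #|A| ^ L)%N; last by ring.
  by rewrite leq_mul2l h2 orbT.
rewrite -(leq_pmul2r (_ : 0 < 2 ^ t)%N) ?expn_gt0 // mulnAC.
apply: leq_trans (leq_mul Kt (leqnn _)) _.
rewrite [X in (_ <= X)%N](_ : _ = P * #|A| ^ L *
  (2 * (#|state C| * c.+1).+1 * m ^ 4 * (256 * 2 ^ t)))%N; last by ring.
rewrite -[X in (X <= _)%N]mulnA leq_mul2l; apply/orP; right.
apply: (@leq_trans ((#|state C| * c.+1).+1 * L.+1 ^ 2 * (2 * L.+1 ^ 2))).
  by apply: leq_mul => //; rewrite expnS expn1; nia.
rewrite [X in (X <= _)%N](_ : _ = 2 * (#|state C| * c.+1).+1 * L.+1 ^ 4)%N; last by ring.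
rewrite -[X in (_ <= X)%N]mulnA leq_mul2l; apply/orP; right.
apply: (@leq_trans ((m * t.+1) ^ 4)); first by rewrite leq_exp2r.
by rewrite expnMn leq_mul2l expn4_le orbT.
Qed.

Lemma flatten_blocks (y : stream A) k N :
  flatten [seq tval (blocks y k N i) | i <- enum 'I_N] = [seq y i | i <- iota 0 (N * k)].
Proof.
transitivity (flatten [seq [seq y (i * k + j)%N | j <- iota 0 k] | i <- iota 0 N]).
  rewrite -(val_enum_ord N) -map_comp; congr flatten; apply: eq_map => i /=.
  by rewrite ffunE startE.
elim: N => // N IH; rewrite -addn1 iotaD map_cat flatten_cat IH /= cats0 add0n.
rewrite addn1 mulSnr iotaD map_cat add0n; congr (_ ++ _).
by rewrite -[in RHS](addn0 (N * k)%N) iotaDl -map_comp; apply: eq_map.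
Qed.

Definition often_compressed (C : kautomaton A 3) m (x y : stream A) : Prop :=
  exists (r : nat -> transition C) z, accepting_run r (tapes3 x y z) /\
  forall L0, exists n, (L0 <= tape_size r c0 n)%N /\
    (tape_size r c2 n * m + tape_size r c0 n <= tape_size r c0 n * m)%N.

Lemma compressor_null (C : kautomaton A 3) m : compressor C -> (0 < m)%N ->
  null R [set xy | often_compressed C m xy.1 xy.2].
Proof.
move=> comp m0.
have [s sync] := synchronizing_word comp.1.
have [D DP] := card_compressed_growth comp sync m0.
pose N L := (3 * (2 * #|A| ^ size s).-1 * L)%N.
pose P L := finset (fun p => `[< @compressed A C L (size s) (N L) (L - L %/ m) p >]).
pose word L (e : L.-tuple A * {ffun 'I_(N L) -> (size s).-tuple A}) :=
  (tval e.1, flatten [seq tval (e.2 i) | i <- enum 'I_(N L)]).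
(* For fixed [L] all cylinders have the same weight, so bounding the weight amounts to counting. *)
have size_word L (e : L.-tuple A * {ffun 'I_(N L) -> (size s).-tuple A}) :
    size (word L e).1 + size (word L e).2 = (L + N L * size s)%N.
  rewrite /= size_tuple; congr (_ + _)%N.
  rewrite size_flatten sumnE /shape 2!big_map big_enum /=.
  rewrite (eq_bigr (fun=> size s)) => [|i _]; last by rewrite size_tuple.
  by rewrite sum_nat_const card_ord.
apply: (@null_borel_cantelli R A _ (fun L => mem [seq word L e | e <- enum (P L)]) D).
  move=> L F uF PF.
  have w_const p : p \in F -> weight R p = ((#|A|%:R ^+ (L + N L * size s))^-1)%R.
    move/(allP PF)/mapP => [e _ ->]; by rewrite /weight /cyl_weight size_word.
  rewrite (eq_big_seq _ w_const) big_const_seq count_predT iter_addr_0 -[X in (X <= _)%R]mulr_natl.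
  have szF : (size F <= #|P L|)%N.
    rewrite cardE -(size_map (word L)); apply: uniq_leq_size => // p.
    by move/(allP PF).
  have A0 : (0 < #|A|%:R :> R)%R by rewrite ltr0n ltnW.
  rewrite ler_pdivrMr ?exprn_gt0 // mulrAC ler_pdivlMr; last first.
    by rewrite mulr_gt0 ?ltr0n.
  rewrite -!natrM -natrX -natrM ler_nat.
  apply: (@leq_trans (#|P L| * (L.+1 * L.+2))); first by rewrite leq_mul2r szF orbT.
  apply: leq_trans (DP L (N L) erefl) _; rewrite leq_mul2l; apply/orP; right.
  by rewrite -!expnM -expnD addnC (mulnC (size s)).
move=> [x y] /= [r [z [acc often]]] L0; have [n [le cmp]] := often L0.
pose L := tape_size r c0 n; exists L; split=> //.
pose e := (start x L, blocks y (size s) (N L)).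
exists (word L e).
  apply: map_f; rewrite mem_enum finset.in_set; apply/asboolP.
  exists r, x, y, z, n; split=> //.
  (* Multiplied by [m], the output length is at most L m - L, hence at most (L - [L %/ m]) m. *)
  rewrite -(leq_pmul2r m0) mulnBl; have := leq_divM L m; rewrite -/L in cmp *; lia.
rewrite /word /= flatten_blocks startE; split; rewrite /= size_map size_iota //.
Qed.

End CompressorNull.

(** * Renaming states to obtain countably many compressors *)

Section Relabelling.
Variables (A : finType) (C : kautomaton A 3).

Definition relabel : kautomaton A 3 :=
  @KAutomaton A 3 'I_#|state C|
    (finset (fun t => (enum_val t.1.1, t.1.2, enum_val t.2) \in delta C))
    (finset (fun q => enum_val q \in initial C)).

Lemma relabel_compressor : compressor C -> compressor relabel.
Proof.
move=> [[[q0 ini] det] inj]; split; last first.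
  have back x y z : realizes3 relabel x y z -> realizes3 C x y z.
    move=> [r acc]; exists (map_transition (M' := C) (fun q : state relabel => enum_val q) \o r).
    by apply: map_accepting acc => [t|q]; rewrite finset.in_set.
  by move=> y x x' z /back ? /back; exact: inj.
split.
  exists (enum_rank q0 : state relabel) => q; rewrite finset.in_set ini; split=> [<-|->].
    by rewrite enum_valK.
  by rewrite enum_rankK.
move=> p q q' a a'; rewrite !finset.in_set /= => /det H /H[eps fn]; split=> // /fn[eqa eqq].
by split=> //; exact: enum_val_inj eqq.
Qed.

Lemma relabel_run (r : nat -> transition C) z : accepting_run r z ->
  exists2 r' : nat -> transition relabel, accepting_run r' z &
    forall j n, tape_size r' j n = tape_size r j n.
Proof.
move=> acc; exists (map_transition (M' := relabel) (fun q => enum_rank q) \o r).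
  apply: map_accepting acc => [t|q]; rewrite finset.in_set /= !enum_rankK //.
  by rewrite -!surjective_pairing.
by move=> j n; rewrite /tape_size; congr size; exact: eq_tape_prefix.
Qed.

End Relabelling.

Section Main.
Variables (R : realType) (A : finType).
Hypothesis A2 : (2 <= #|A|)%N.
Local Open Scope classical_set_scope.

(** A conditional ratio below 1 is witnessed by a compressor, whose states may be renamed to some
    ['I_n], and by a saving 1/m. For each [n] there are finitely many such automata, so the union is
    countable. *)
Lemma rho_cond_lt1_null :
  null R [set xy : stream A * stream A | (rho_cond R xy.1 xy.2 < 1)%E].
Proof.
pose code n := ({set ('I_n * 3.-tuple (option A) * 'I_n)} * {set 'I_n})%type.
pose aut n (e : code n) : kautomaton A 3 := @KAutomaton A 3 'I_n e.1 e.2.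
apply: (null_subset (S' := [set xy | exists n, exists e : code n, exists m,
    compressor (aut n e) /\ often_compressed (aut n e) m.+1 xy.1 xy.2])).
  move=> [x y] /ereal_inf_lt[_ /= [C [r [z [comp [acc ->]]]]] lt1].
  have [m [m0 often]] := run_ratio_lt1 lt1 (proj2 (proj2 (proj2 acc) c0)).
  have [r' acc' sz] := relabel_run acc.
  exists #|state C|, (delta (relabel C), initial (relabel C)), m.-1.
  split; first exact: relabel_compressor.
  exists r', z; split=> // L0; have [n H] := often L0; exists n.
  by rewrite prednK // !sz.
apply: null_exists => n; apply: null_exists => e; apply: null_exists => m.
case: (pselect (compressor (aut n e))) => [comp|ncomp].
  by apply: (null_subset _ (compressor_null A2 comp (ltn0Sn m))) => xy [].
(* For a code that is not a compressor the set is empty, hence contained in a union over [void]. *)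
by apply: (null_subset _ (null_exists (I := void) (S := fun=> setT) _)) => [xy []|[]].
Qed.

End Main.

Local Open Scope classical_set_scope.

(* mu(I) = 1 for the (completed) uniform product measure mu, i.e. the
   complement of I is mu-null: its Lebesgue outer measure is 0. *)
Theorem theorem16 (R : realType) (A : finType) (hA : (2 <= #|A|)%N) :
  lebesgue_outer R (~` [set xy : stream A * stream A | fs_independent R xy.1 xy.2])
  = 0%E.
Proof.
apply: null_lebesgue_outer => //.
have nul := @rho_cond_lt1_null R A hA.
(* The boolean selects the direction of the conditional ratio; the two sets are exchanged by
   swapping coordinates, which preserves weights. *)
apply: (null_subset (S' := [set xy | exists b : bool,
    (rho_cond R (if b then xy.1 else xy.2) (if b then xy.2 else xy.1) < 1)%E])).
  move=> [x y] /= nind; apply: contrapT => h; apply: nind.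
  by apply: fs_independent_of_rho_cond; rewrite leNgt; apply/negP => lt; apply: h;
    [exists true | exists false].
apply: null_exists => -[] //; exact: (null_swap nul).
Qed.
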